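(* Let $n\geq 7$ be an odd number and let $G=\langle g\rangle$ be a cyclic group of order $n$. Let $S=0^{n-3}\cdot g^{n-3}\cdot (2g)\cdot ((n-1)g)$ and $r=|S|-n=n-4$. Then $|S|=n+r$ and $0\notin \Sigma_{n}(S)$, and for every zero-sum free sequence $T$ over $G$ with $|T|=r+1$, we have either $|\Sigma_{n}(S)| < |\Sigma(T)|$ or $|\mathrm{supp}(T)|< \min\{r+1, |\mathrm{supp}(S)|-1\}$.
   Context: $G$ is written additively. A sequence over $G$ is a finite unordered sequence (multiset) of elements of $G$, repetition allowed, written multiplicatively as an element of the free abelian monoid with basis $G$: $S=g_1\cdot\ldots\cdot g_\ell=\prod_{h\in G} h^{\mathsf v_h(S)}$, where $\mathsf v_h(S)\ge 0$ is the multiplicity of $h$ in $S$. So $h^{m}$ denotes the sequence consisting of $h$ repeated $m$ times (in particular $0^{n-3}$ is the zero element of $G$ repeated $n-3$ times), and $(2g)$, $((n-1)g)$ denote single terms equal to those group elements. $|S|=\ell$ is the length of $S$ (counted with multiplicity), $\mathrm{supp}(S)=\{h\in G: \mathsf v_h(S)>0\}$ is the set of distinct terms, and $\sigma(S)=g_1+\cdots+g_\ell\in G$ is the sum. A subsequence $T$ of $S$ is a sequence with $\mathsf v_h(T)\le \mathsf v_h(S)$ for all $h\in G$. For $k\in[1,|S|]$, $\Sigma_k(S)=\{\sigma(T): T \text{ is a subsequence of } S \text{ with } |T|=k\}$, and $\Sigma(S)=\bigcup_{k=1}^{|S|}\Sigma_k(S)$. $S$ is zero-sum free if $0\notin\Sigma(S)$.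 *)

(* Defs.v *)
From mathcomp Require Import all_boot all_algebra all_fingroup.
From mathcomp Require Import finmap multiset boolp.

Set Implicit Arguments.
Unset Strict Implicit.
Unset Printing Implicit Defensive.

Import GRing.Theory.

Local Open Scope mset_scope.
Local Open Scope ring_scope.

(* A sequence over G is a finite multiset S : {mset G}, with multiplicities
   S h.  Its length |S| is size S, counted with multiplicity; beware that #|S|
   instead counts the distinct terms. *)

Definition sigma (G : finZmodType) (S : {mset G}) : G := \sum_(x <- S) x.

Definition supp (G : finZmodType) (S : {mset G}) : {set G} := [set h | 0 < S h]%N.

Definition Sigma_k (G : finZmodType) (k : nat) (S : {mset G}) : {set G} :=
  [set x | `[< exists T : {mset G},
                 [/\ (T `<=` S)%mset, size T = k & sigma T = x] >]].

Definition Sigma (G : finZmodType) (S : {mset G}) : {set G} :=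
  \bigcup_(1 <= k < (size S).+1) Sigma_k k S.

Definition zero_sum_free (G : finZmodType) (S : {mset G}) : Prop :=
  0 \notin Sigma S.

(* Main.v *)
(** A zero-sum free T of length r + 1 = n - 3 cannot have three distinct terms
    a, b, c, so the support alternative always holds (min (r + 1) 3 = 3).
    Indeed |Sigma| of a zero-sum free sequence grows by at least one with each
    added term, and |Sigma (a b c)| >= 6: the four sums of at least two terms
    are distinct, and two of the relations a = b + c, b = a + c, c = a + b
    together would give an element of order 2, impossible for n odd.  Hence
    |Sigma T| >= (n - 6) + 6 = n, which forces 0 into Sigma T. *)

Require Import Defs.
From mathcomp Require Import all_boot all_algebra all_fingroup.
From mathcomp Require Import finmap multiset boolp zify cyclic.

Import GRing.Theory.

Local Open Scope mset_scope.
Local Open Scope ring_scope.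

(** * Lengths and subsequences of multisets *)

Lemma perm_msetD {K : choiceType} (A B : {mset K}) :
  perm_eq (A `+` B)%mset (A ++ B).
Proof. by apply/allP => x _ /=; rewrite count_cat !count_mem_mset msetE2. Qed.

Lemma size_msetD {K : choiceType} (A B : {mset K}) :
  size (A `+` B)%mset = (size A + size B)%N.
Proof. by rewrite (perm_size (perm_msetD A B)) size_cat. Qed.

Lemma size_msetn {K : choiceType} k (x : K) : size (msetn k x) = k.
Proof. by rewrite enum_msetn size_nseq. Qed.

Lemma msubset_msetn {K : choiceType} {T : {mset K}} {k x} :
  (T `<=` msetn k x)%mset -> exists2 j, (j <= k)%N & T = msetn j x.
Proof.
move=> /msubsetP le; exists (T x); first by have := le x; rewrite msetnxx.
apply/msetP => y; have := le y; rewrite !msetnE.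
by case: eqP => [-> //|_]; rewrite leqn0 => /eqP.
Qed.

Lemma leq_msetn {K : choiceType} (x : K) i k :
  (i <= k)%N -> (msetn i x `<=` msetn k x)%mset.
Proof. by move=> ik; apply/msubsetP => y; rewrite !msetnE; case: eqP. Qed.

(** Taking as much of [T] as possible from [A] leaves a rest that fits in [B]. Iterated, this
    describes a subsequence of the given [S] by four exponents. *)
Lemma msubset_msetD {K : choiceType} {T A B : {mset K}} :
  (T `<=` A `+` B)%mset ->
  exists T1 T2,
    [/\ (T1 `<=` A)%mset, (T2 `<=` B)%mset & T = (T1 `+` T2)%mset].
Proof.
move=> TAB; exists (T `&` A)%mset, (T `\` A)%mset.
split; [exact: msubsetIr | by rewrite subset_msetBLR |].
by apply/msetP => x; rewrite !msetE2; lia.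
Qed.

Lemma msubset_addl {K : choiceType} (A B : {mset K}) : (B `<=` A `+` B)%mset.
Proof. by apply/msubsetP => x; rewrite msetE2 leq_addl. Qed.

(** * Subsequence sums and how many there are *)

Section Sums.
Context {G : finZmodType}.
Implicit Types (A B S T U : {mset G}) (a b c h x : G).

Lemma sigmaD A B : sigma (A `+` B)%mset = sigma A + sigma B.
Proof. by rewrite /sigma (perm_big _ (perm_msetD A B)) big_cat. Qed.

Lemma sigma_msetn k x : sigma (msetn k x) = x *+ k.
Proof.
by rewrite /sigma enum_msetn big_nseq; elim: k => //= k ->; rewrite mulrS.
Qed.

Lemma sigma_mset0 : sigma (mset0 : {mset G}) = 0.
Proof. by rewrite /sigma enum_mset0 big_nil. Qed.

Lemma SigmaP S x :
  reflect (exists T, [/\ (T `<=` S)%mset, T != mset0 & sigma T = x])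
          (x \in Sigma S).
Proof.
have -> : (x \in Sigma S) =
    has (fun k => x \in Sigma_k k S) (index_iota 1 (size S).+1).
  rewrite /Sigma; elim: (index_iota _ _) => [|k s IHs] /=.
    by rewrite big_nil inE.
  by rewrite big_cons inE IHs.
apply: (iffP hasP) => [[k] | [T [TS T0 Tx]]].
  rewrite mem_index_iota inE => /andP[k_gt0 _] /asboolP[T [TS Tk Tx]].
  by exists T; split; rewrite // -size_mset_eq0 Tk -lt0n.
exists (size T); last by rewrite inE; apply/asboolP; exists T.
rewrite mem_index_iota lt0n size_mset_eq0 T0 ltnS /=.
by rewrite -(msetBDK TS) size_msetD leq_addl.
Qed.

Lemma zsf_sigma S T : zero_sum_free S -> (T `<=` S)%mset -> T != mset0 ->
  sigma T != 0.
Proof.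
by move=> S0 TS T0; apply: contra S0 => /eqP sT; apply/SigmaP; exists T.
Qed.

Lemma zsf_msubset S T : zero_sum_free S -> (T `<=` S)%mset -> zero_sum_free T.
Proof.
move=> S0 TS; apply: contra S0 => /SigmaP[U [UT U0 sU]].
by apply/SigmaP; exists U; split=> //; apply: msubset_trans TS.
Qed.

(** Adjoining 0 accounts for the empty subsequence, which [Sigma] excludes. *)
Lemma sigma_in_Sigma0 S T : (T `<=` S)%mset -> sigma T \in 0 |: Sigma S.
Proof.
move=> TS; rewrite !inE; have [->|T0] := eqVneq T mset0.
  by rewrite sigma_mset0 eqxx.
by apply/orP; right; apply/SigmaP; exists T.
Qed.

Lemma Sigma0P S x :
  x \in 0 |: Sigma S -> exists2 T, (T `<=` S)%mset & sigma T = x.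
Proof.
rewrite !inE => /orP[/eqP->|/SigmaP[T [TS _ sT]]]; last by exists T.
by exists mset0; [apply: msub0set | apply: sigma_mset0].
Qed.

(* Otherwise A := 0 |: Sigma U would be invariant under translation by h, so
   that -h would lie in A. *)
Lemma card_Sigma_mset1D h U : zero_sum_free (h +` U)%mset ->
  (#|Sigma U| < #|Sigma (h +` U)|)%N.
Proof.
move=> zU; have zU0 := zsf_msubset _ _ zU (msubset_addl _ _).
set A := 0 |: Sigma U; set B := 0 |: Sigma (h +` U)%mset.
(* By zero-sum freeness 0 lies in neither [Sigma], so adjoining it raises both cardinals by one. *)
suff : (#|A| < #|B|)%N.
  by rewrite /A /B !cardsU1 (negbTE zU) (negbTE zU0).
have AB : A \subset B.
  apply/subsetP => x /Sigma0P[T TU <-]; apply: sigma_in_Sigma0.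
  exact: msubset_trans (msubset_addl _ _).
have hAB : [set h + x | x in A] \subset B.
  apply/subsetP => _ /imsetP[x /Sigma0P[T TU <-] ->].
  rewrite -{1}[h]mulr1n -sigma_msetn -sigmaD; apply: sigma_in_Sigma0.
  exact: msetDS.
rewrite ltnNge; apply/negP => leBA.
have eAB : A = B by apply/eqP; rewrite eqEcard AB.
have hA : [set h + x | x in A] = A.
  apply/eqP; rewrite eqEcard card_imset ?leqnn ?andbT; last exact: addrI.
  by rewrite {2}eAB.
have : 0 \in [set h + x | x in A] by rewrite hA setU11.
case/imsetP => _ /Sigma0P[T TU <-] /esym/eqP.
rewrite -{1}[h]mulr1n -sigma_msetn -sigmaD; apply/negP.
apply: zsf_sigma zU _ _; first exact: msetDS.
by rewrite -size_mset_eq0 size_msetD size_msetn.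
Qed.

Lemma card_Sigma_msetD U S : zero_sum_free (U `+` S)%mset ->
  (size U + #|Sigma S| <= #|Sigma (U `+` S)%mset|)%N.
Proof.
rewrite -(seq_mset_id U) (perm_size (perm_eq_seq_mset _)).
elim: (enum_mset U) => [|h s IHs].
  have -> : seq_mset [::] = mset0 :> {mset G}.
    by apply/msetP => x; rewrite mset_seqE mset0E.
  by rewrite mset0D.
rewrite mset_cons -msetDA => z.
apply: leq_ltn_trans (card_Sigma_mset1D _ _ z).
exact: IHs (zsf_msubset _ _ z (msubset_addl _ _)).
Qed.

Lemma card_Sigma3 a b c : (forall x, x *+ 2 = 0 -> x = 0) ->
  uniq [:: a; b; c] -> zero_sum_free [mset a; b; c] ->
  (6 <= #|Sigma [mset a; b; c]|)%N.
Proof.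
move=> no2 abc z.
(* The booleans select which of [a], [b], [c] enter the sum. *)
have in_Sig (i j k : bool) : i || j || k ->
    a *+ i + b *+ j + c *+ k \in Sigma [mset a; b; c].
  move=> ijk; apply/SigmaP.
  exists (msetn i a `+` msetn j b `+` msetn k c)%mset; split.
  - by do 2?[apply: msetDSS]; apply: leq_msetn; apply: leq_b1.
  - rewrite -size_mset_eq0 !size_msetD !size_msetn.
    by move: ijk; case: i j k => [] [] [].
  - by rewrite !sigmaD !sigma_msetn.
have S100 := in_Sig true false false isT.
have S010 := in_Sig false true false isT.
have S001 := in_Sig false false true isT.
have S110 := in_Sig true true false isT.
have S101 := in_Sig true false true isT.
have S011 := in_Sig false true true isT.
have S111 := in_Sig true true true isT.
rewrite !(mulr0n, mulr1n, addr0, add0r) in S100 S010 S001 S110 S101 S011 S111.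
have nz x : x \in Sigma [mset a; b; c] -> x != 0.
  by apply: contraTneq => ->.
have [a0 b0 c0] := And3 (nz _ S100) (nz _ S010) (nz _ S001).
have [ab0 ac0 bc0] := And3 (nz _ S110) (nz _ S101) (nz _ S011).
have neqD x y : y != 0 -> x != x + y.
  by move=> y0; rewrite -{1}[x]addr0 (inj_eq (addrI x)) eq_sym.
move: abc; rewrite /= !inE negb_or andbT => /andP[/andP[ab ac] bc].
pose P := [:: a + b; a + c; b + c; a + b + c].
have uP : uniq P.
  rewrite /= !inE !negb_or (inj_eq (addrI a)) bc (addrC a b).
  rewrite (inj_eq (addrI b)) ac neqD // (inj_eq (addIr c)) ab.
  by rewrite (addrC b a) (addrAC a b) neqD // -addrA (addrC c) (addrC a) neqD.
have PA : {subset P <= Sigma [mset a; b; c]}.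
  by apply/allP; rewrite /= S110 S101 S011 S111.
(* [P] supplies four sums, so two further elements of [Sigma] suffice; they will be two of the
   single terms. *)
have key x y : x != y -> x \in Sigma [mset a; b; c] ->
    y \in Sigma [mset a; b; c] -> x \notin P -> y \notin P ->
    (6 <= #|Sigma [mset a; b; c]|)%N.
  move=> xy xA yA xP yP; rewrite cardE.
  apply: (@uniq_leq_size _ [:: x, y & P]).
    by rewrite (cons_uniq x) (cons_uniq y) inE negb_or xy xP yP.
  by move=> t; rewrite mem_enum !in_cons => /or3P[/eqP->|/eqP->|/PA].
(* Adding [x = y + t] and [y = x + t] gives [t *+ 2 = 0]. Hence at most one of [a], [b], [c] is the
   sum of the other two. *)
have two x y t : t != 0 -> x = y + t -> y != x + t.
  move=> t0 xE; apply: contra_neq t0 => yE; apply: no2; rewrite mulr2n.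
  by apply: (addrI y); rewrite addrA addr0 -xE -yE.
(* The other three members of [P] are [a] plus a nonzero sum, so only [b + c] can equal [a];
   likewise for [b] and [c]. *)
have aP : a != b + c -> a \notin P.
  by move=> aN; rewrite !inE !negb_or aN !neqD // -addrA neqD.
have bP : b != a + c -> b \notin P.
  by move=> bN; rewrite !inE !negb_or bN (addrC a b) !neqD // -addrA neqD.
have cP : c != a + b -> c \notin P.
  move=> cN; rewrite !inE !negb_or cN (addrC (a + b)) (addrC a c) (addrC b c).
  by rewrite !neqD.
have [aE|/aP {}aP] := eqVneq a (b + c).
  apply: (key b c) => //; first by apply: bP; apply: two c0 aE.
  by apply: cP; rewrite addrC in aE; apply: two b0 aE.
have [bE|/bP {}bP] := eqVneq b (a + c); last by apply: (key a b).
apply: (key a c) => //.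
by apply: cP; rewrite addrC in bE; rewrite addrC; apply: two a0 bE.
Qed.

End Sums.

Theorem theorem1p5 (n : nat) (G : finZmodType) (g : G) (S : {mset G}) (r : nat)
    (n_ge7 : (7 <= n)%N) (n_odd : odd n)
    (G_gen : [set: G] = <[g]>%g) (G_order : #|[set: G]| = n)
    (S_def : S = (msetn (n - 3)%N 0 `+` msetn (n - 3)%N g
                    `+` [mset g *+ 2] `+` [mset g *+ (n - 1)%N])%mset)
    (r_def : r = (size S - n)%N) :
  [/\ r = (n - 4)%N,
      size S = (n + r)%N,
      0 \notin Sigma_k n S &
      forall T : {mset G}, zero_sum_free T -> size T = r.+1 ->
        (#|Sigma_k n S| < #|Sigma T|)%N \/
        (#|supp T| < minn r.+1 (#|supp S| - 1))%N].
Proof.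
have og : #[g]%g = n by rewrite /order -G_gen.
have gE i j : (g *+ i == g *+ j) = (i == j %[mod n]).
  by rewrite -!FinRing.zmodXgE eq_expg_mod_order og.
have szS : size S = (2 * n - 4)%N.
  by rewrite S_def !size_msetD !size_msetn; lia.
have no2 x : x *+ 2 = 0 -> x = 0 :> G.
  move=> x2; have xn : x *+ n = 0.
    by rewrite -FinRing.zmodXgE -G_order expg_cardG ?inE.
  by rewrite -xn -(odd_double_half n) n_odd mulrS -mul2n mulrnA x2 mul0rn addr0.
(* The multiples 0, 1, 2 and [n - 1] of [g] are distinct, so [minn r.+1 (#|supp S| - 1)] is at least
   3. *)
have suppS : (4 <= #|supp S|)%N.
  rewrite cardE; apply: (@uniq_leq_size _
    [:: g *+ 0; g *+ 1; g *+ 2; g *+ (n - 1)]).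
    by rewrite /= !inE !gE !modn_small //; lia.
  move=> x; rewrite mem_enum !inE S_def !msetE2 !msetnE mulr0n mulr1n.
  by case/or4P => /eqP ->; rewrite eqxx; lia.
split; [lia | lia | |].
  (* A subsequence of length [n] takes 0, [g], [2g], [-g] with exponents [a], [b], [c], [d], and its
     sum is [b + 2c - d] times [g]. Since [a <= n - 3], [b + c + d >= 3]. *)
  rewrite inE; apply/negP => /asboolP[T []]; rewrite S_def.
  move=> /msubset_msetD[_ [D [/msubset_msetD[_ [C [/msubset_msetD
    [A [B [+ + ->]]] + ->]]] + ->]]].
  move=> /msubset_msetn[a a_le ->] /msubset_msetn[b b_le ->].
  move=> /msubset_msetn[c c_le ->] /msubset_msetn[d d_le ->].
  rewrite !size_msetD !size_msetn !sigmaD !sigma_msetn mul0rn add0r => size_n.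
  rewrite -!mulrnA -!mulrnDr => /eqP; rewrite -[0](mulr0n g) gE mod0n.
  (* If [d = 0], then [0 < b + 2c <= n - 1]. If [d = 1], then [b + c >= 2] gives
     [0 < b + 2c - 1 <= n - 2]. Neither is divisible by [n]. *)
  case: d d_le size_n => [|[|//]] _ size_n.
    rewrite modn_small; lia.
  have -> : (b + 2 * c + (n - 1) * 1 = (b + 2 * c - 1) + n)%N by lia.
  rewrite modnDr modn_small; lia.
move=> T zT szT; right.
suff : (#|supp T| <= 2)%N by lia.
rewrite leqNgt; apply/negP => /card_gt2P[a [b [c [[aT bT cT] [ab bc ca]]]]].
rewrite !inE in aT bT cT.
have abcT : ([mset a; b; c] `<=` T)%mset.
  apply/msubsetP => x; rewrite !msetE2 !msetnE.
  by do ![case: eqP => [?|_] //]; subst; rewrite ?eqxx in ab bc ca.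
have le_T : (size (T `\` [mset a; b; c])%mset + #|Sigma [mset a; b; c]|
    <= #|Sigma T|)%N.
  by rewrite -{2}(msetBDK abcT); apply: card_Sigma_msetD; rewrite msetBDK.
have le_6 : (6 <= #|Sigma [mset a; b; c]|)%N.
  apply: (card_Sigma3 _ _ _ no2); last exact: zsf_msubset zT abcT.
  by rewrite /= !inE negb_or ab bc eq_sym ca.
have lt_n : (#|Sigma T| < n)%N.
  rewrite -G_order; apply: proper_card; rewrite properE subsetT /=.
  by apply/subsetPn; exists 0; rewrite ?inE.
(* As [size T = n - 3], [n - 6] terms remain, so [le_T] and [le_6] contradict [lt_n]. *)
have : size T = (size (T `\` [mset a; b; c])%mset + 3)%N.
  by rewrite -{1}(msetBDK abcT) !size_msetD !size_msetn.
rewrite szT => szU.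
lia.
Qed.
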